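(* Assume the independent sampling setting described in the context, with $p=F(\tau)\in(0,1)$. (a) Suppose $G_m^{-1}(p)$ is a quantile estimator of $G^{-1}(p)$, calculated from the additional sample, such that $\sqrt{m}\,(G_m^{-1}(p)-G^{-1}(p))\stackrel{d}{\to}V$ as $m\to\infty$ for some random variable $V$. Then $$T_{n1}=\overline{X}_1^*-\sqrt{n_1}\,G_m^{-1}(p)+o_P(1),$$ as $n_1\to\infty$ with $n_1/m=o(1)$, and $$T_{n2}=\overline{X}_2^*-\sqrt{n_2}\,G_m^{-1}(p)+o_P(1),$$ as $n_2\to\infty$ with $n_2/m=o(1)$. (b) Suppose instead that a quantile estimator $F_m^{-1}(p)$ of $F_0^{-1}(p)$, calculated from the additional sample, is available such that $\sqrt{m}\,(F_m^{-1}(p)-F_0^{-1}(p))\stackrel{d}{\to}U$ as $m\to\infty$ for some random variable $U$. Then both expansions in (a) still hold true, under the same limit regimes, with $$G_m^{-1}(p):=\frac{F_m^{-1}(p)-\overline{X}_0}{S_m}.$$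
   Context: Distributional model. $F$ is a distribution function with finite fourth moment, mean $\mu$ and variance $\sigma^2\in(0,\infty)$, and $F(x)=G((x-\mu)/\sigma)$, where $G$ is a fixed unknown distribution function with $\int x\,dG(x)=0$ and $\int x^2\,dG(x)=1$. Quantile functions are denoted $F^{-1}$, $G^{-1}$, so that $F^{-1}(p)=\mu+\sigma G^{-1}(p)$. The number $\tau$ is a specification limit; an item with measurement $X\le\tau$ is non-conforming, and $p=F(\tau)$ is the fraction of non-conforming items, with $\tau=F^{-1}(p)$. Samples. - The additional sample $X_{01},\dots,X_{0m}$ (time $t_0$) is i.i.d. with distribution function $F_0(x)=F(x-\Delta)$ for some constant $\Delta\in\mathbb{R}$. Its mean is $\mu_0=\mu+\Delta$ and its variance is $\sigma_0^2=\sigma^2$. - The control sample $X_{11},\dots,X_{1n_1}$ (time $t_1$) is i.i.d. with distribution function $F$. - The inspection sample $X_{21},\dots,X_{2n_2}$ (time $t_2$) is i.i.d. with distribution function $F$. (Inspection measurements are in general distributed as $dX$ with $X\sim F$ and a known degradation constant $d\in(0,\infty)$; the convention is that they have already been multiplied by $D=1/d$.) Independent sampling: the samples taken at times $t_1$ and $t_2$ are independent of each other. Statistics. $\overline{X}_0=\frac1m\sum_{i=1}^mX_{0i}$, $S_m=\sqrt{\frac{1}{m-1}\sum_{i=1}^m(X_{0i}-\overline{X}_0)^2}$, and, for $i=1,2$, $\overline{X}_i=\frac{1}{n_i}\sum_{j=1}^{n_i}X_{ij}$, $$T_{ni}=\sqrt{n_i}\,\frac{\overline{X}_i-\tau}{S_m},\qquad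 \overline{X}_i^*=\sqrt{n_i}\,\frac{\overline{X}_i-\mu}{\sigma}.$$ Here $o_P(1)$ denotes a term converging to $0$ in probability. *)

(* Defs.v *)
From HB Require Import structures.
From mathcomp Require Import all_boot all_order all_algebra finmap.
From mathcomp Require Import all_classical all_reals all_analysis.

Set Implicit Arguments.
Unset Strict Implicit.
Unset Printing Implicit Defensive.

Import Order.TTheory GRing.Theory Num.Theory.
Import numFieldNormedType.Exports.

Local Open Scope classical_set_scope.
Local Open Scope ring_scope.

Definition quantile (R : realType) (F : R -> R) (p : R) : R :=
  inf [set x | p <= F x].

(* Samples are initial segments of infinite sequences of random variables,
   indexed from 0: the i-th observation is X i.-1. *)
Definition sample (d : measure_display) (T : measurableType d) (R : realType)
    (P : probability T R) (X : nat -> {RV P >-> R}) (n : nat) (w : T) :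
    n.-tuple R :=
  [tuple X i w | i < n].

Definition mutually_independent (d : measure_display) (T : measurableType d)
    (R : realType) (P : probability T R) (X : nat -> {RV P >-> R}) : Prop :=
  forall (J : {fset nat}) (A : nat -> set R), (forall i, measurable (A i)) ->
    P (\bigcap_(i in [set` J]) (X i @^-1` A i)) =
    (\prod_(i <- J) P (X i @^-1` A i))%E.

Definition iid (d : measure_display) (T : measurableType d) (R : realType)
    (P : probability T R) (X : nat -> {RV P >-> R}) (F : R -> R) : Prop :=
  (forall i x, cdf (X i) x = (F x)%:E) /\ mutually_independent X.

Definition independent_samples (d : measure_display) (T : measurableType d)
    (R : realType) (P : probability T R) (X Y : nat -> {RV P >-> R}) : Prop :=
  forall (n1 n2 : nat) (A : set (n1.-tuple R)) (B : set (n2.-tuple R)),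
    measurable A -> measurable B ->
    P (sample X n1 @^-1` A `&` sample Y n2 @^-1` B) =
    (P (sample X n1 @^-1` A) * P (sample Y n2 @^-1` B))%E.

Definition sample_mean (R : realType) (n : nat) (x : n.-tuple R) : R :=
  (\sum_(i < n) tnth x i) / n%:R.

Definition sample_sd (R : realType) (n : nat) (x : n.-tuple R) : R :=
  Num.sqrt ((\sum_(i < n) (tnth x i - sample_mean x) ^+ 2) / (n.-1)%:R).

(* Y n must be measurable for the probabilities below to be meaningful. *)
Definition cvg_in_distribution (d d' : measure_display) (T : measurableType d)
    (T' : measurableType d') (R : realType) (P : probability T R)
    (P' : probability T' R) (Y : nat -> T -> R) (V : {RV P' >-> R}) : Prop :=
  forall x : R, {for x, continuous (cdf V)} ->
    P [set w | Y n w <= x] @[n --> \oo] --> cdf V x.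

Definition oP1 (d : measure_display) (T : measurableType d) (R : realType)
    (P : probability T R) (Y : nat -> T -> R) : Prop :=
  forall eps : R, 0 < eps ->
    P [set w | eps <= `|Y k w|] @[k --> \oo] --> 0%E.

(* q m is a statistic of a sample of size m. *)
Definition estimator (R : realType) (q : forall m : nat, m.-tuple R -> R) :
    Prop :=
  forall m : nat, measurable_fun [set: m.-tuple R] (@q m).

Definition control_statistic (R : realType) (tau : R) (n m : nat)
    (x : n.-tuple R) (x0 : m.-tuple R) : R :=
  Num.sqrt n%:R * ((sample_mean x - tau) / sample_sd x0).

Definition standardized_mean (R : realType) (mu sigma : R) (n : nat)
    (x : n.-tuple R) : R :=
  Num.sqrt n%:R * ((sample_mean x - mu) / sigma).

(* The limit regime is a pair of sequences of sample sizes. The divergence of m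
   is stated separately because n k / m k = 0 when m k = 0. *)
Definition expansion (d : measure_display) (T : measurableType d)
    (R : realType) (P : probability T R) (mu sigma tau : R)
    (X X0 : nat -> {RV P >-> R}) (q : forall m : nat, m.-tuple R -> R) : Prop :=
  forall n m : nat -> nat,
    n k @[k --> \oo] --> \oo -> m k @[k --> \oo] --> \oo ->
    ((n k)%:R / (m k)%:R : R) @[k --> \oo] --> (0 : R) ->
    oP1 P (fun k w =>
      control_statistic tau (sample X (n k) w) (sample X0 (m k) w)
      - (standardized_mean mu sigma (sample X (n k) w)
         - Num.sqrt (n k)%:R * q (m k) (sample X0 (m k) w))).

(* Main.v *)
(* With r = sigma / S_m - 1 and g = G^-1(p), the remainder of the expansion is
   exactly  Xbar^* r + sqrt n (G_m^-1(p) - g) - sqrt n g r.  Since Xbar^* is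
   O_P(1) by Chebyshev, and sqrt m r and sqrt m (G_m^-1(p) - g) are O_P(1) (by the
   fourth moment, and because convergence in distribution implies tightness), each
   term is o_P(1) as n / m -> 0.  For (b),
     G_m^-1(p) - g = (F_m^-1(p) - F_0^-1(p)) / S_m - (Xbar_0 - mu_0) / S_m + g r,
   so that the estimator of (b) satisfies the tightness used in (a). *)
Require Import Defs.
From HB Require Import structures.
From mathcomp Require Import all_boot all_order all_algebra finmap.
From mathcomp Require Import all_classical all_reals all_analysis.
From mathcomp Require Import measurable_realfun ring lra.

Set Implicit Arguments.
Unset Strict Implicit.
Unset Printing Implicit Defensive.

Import Order.TTheory GRing.Theory Num.Theory.
Import numFieldNormedType.Exports.

Local Open Scope classical_set_scope.
Local Open Scope ring_scope.

(* [Op P Y] is [Y = O_P(1)] and [op P Y] is [Y = o_P(1)], phrased with measurable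
   exceptional sets so that no measurability of [Y k] is needed to combine them. *)
Definition Op (d : measure_display) (T : measurableType d) (R : realType)
    (P : probability T R) (Y : nat -> T -> R) : Prop :=
  forall eps : R, 0 < eps -> exists M : R, \forall k \near \oo,
    exists A : set T, [/\ measurable A, (P A <= eps%:E)%E &
      forall w, ~ A w -> `|Y k w| <= M].

Definition op (d : measure_display) (T : measurableType d) (R : realType)
    (P : probability T R) (Y : nat -> T -> R) : Prop :=
  forall eps delta : R, 0 < eps -> 0 < delta -> \forall k \near \oo,
    exists A : set T, [/\ measurable A, (P A <= eps%:E)%E &
      forall w, ~ A w -> `|Y k w| <= delta].

(** * Calculus of the stochastic orders O_P(1) and o_P(1) *)

Section stochastic_order.
Context (d : measure_display) (T : measurableType d) (R : realType).
Context (P : probability T R).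
Implicit Types (Y Z : nat -> T -> R) (c : nat -> R).

Lemma probability_setU_le (A B : set T) (a : R) : measurable A ->
  measurable B -> (P A <= (a / 2)%:E)%E -> (P B <= (a / 2)%:E)%E ->
  (P (A `|` B) <= a%:E)%E.
Proof.
move=> mA mB PA PB; apply: (le_trans (measureU2 _ mA mB)).
have -> : a%:E = ((a / 2)%:E + (a / 2)%:E)%E by rewrite -EFinD -splitr.
exact: leeD.
Qed.

Lemma Op_le Y Z : Op P Z ->
  (\forall k \near \oo, forall w, `|Y k w| <= `|Z k w|) -> Op P Y.
Proof.
move=> OZ YZ eps eps0; have [M HM] := OZ _ eps0; exists M.
apply: filterS2 HM YZ => k [A [mA PA AM]] YZ.
by exists A; split=> // w Aw; apply: le_trans (AM _ Aw).
Qed.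

Lemma Op_cst c : (exists M, \forall k \near \oo, `|c k| <= M) ->
  Op P (fun k _ => c k).
Proof.
move=> [M cM] eps eps0; exists M; apply: filterS cM => k cM.
by exists set0; rewrite measure0 lee_fin ltW.
Qed.

Lemma OpD Y Z : Op P Y -> Op P Z -> Op P (fun k w => Y k w + Z k w).
Proof.
move=> OY OZ eps eps0; have e2 : 0 < eps / 2 by rewrite divr_gt0.
have [M HM] := OY _ e2; have [N HN] := OZ _ e2; exists (M + N).
apply: filterS2 HM HN => k [A [mA PA AM]] [B [mB PB BN]].
exists (A `|` B); split; [exact: measurableU|exact: probability_setU_le|].
by move=> w /not_orP[Aw Bw]; rewrite (le_trans (ler_normD _ _))// lerD ?AM ?BN.
Qed.

Lemma OpM Y Z : Op P Y -> Op P Z -> Op P (fun k w => Y k w * Z k w).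
Proof.
move=> OY OZ eps eps0; have e2 : 0 < eps / 2 by rewrite divr_gt0.
have [M HM] := OY _ e2; have [N HN] := OZ _ e2; exists (M * N).
apply: filterS2 HM HN => k [A [mA PA AM]] [B [mB PB BN]].
exists (A `|` B); split; [exact: measurableU|exact: probability_setU_le|].
by move=> w /not_orP[Aw Bw]; rewrite normrM ler_pM ?AM ?BN.
Qed.

Lemma OpZ (a : R) Y : Op P Y -> Op P (fun k w => a * Y k w).
Proof.
by move=> OY; apply: OpM => //; apply: Op_cst; exists `|a|; apply: nearW.
Qed.

Lemma Op_comp Y (m : nat -> nat) : Op P Y -> m k @[k --> \oo] --> \oo ->
  Op P (fun k => Y (m k)).
Proof.
by move=> OY mo eps eps0; have [M HM] := OY _ eps0; exists M; exact: mo HM.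
Qed.

Lemma opD Y Z : op P Y -> op P Z -> op P (fun k w => Y k w + Z k w).
Proof.
move=> oY oZ eps dl eps0 dl0; have e2 : 0 < eps / 2 by rewrite divr_gt0.
have d2 : 0 < dl / 2 by rewrite divr_gt0.
apply: filterS2 (oY _ _ e2 d2) (oZ _ _ e2 d2) => k [A [mA PA AM]] [B [mB PB BN]].
exists (A `|` B); split; [exact: measurableU|exact: probability_setU_le|].
move=> w /not_orP[Aw Bw]; rewrite (le_trans (ler_normD _ _))//.
by rewrite [leRHS](splitr dl) lerD ?AM ?BN.
Qed.

Lemma op_scale c Y : c k @[k --> \oo] --> (0 : R) -> Op P Y ->
  op P (fun k w => c k * Y k w).
Proof.
move=> c0 OY eps dl eps0 dl0; have [M HM] := OY _ eps0.
(* The bound [M] comes with no sign, so the positive number [|M| + 1] is used as divisor instead. *)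
have M1 : 0 < `|M| + 1 by rewrite ltr_pwDr.
have dM : 0 < dl / (`|M| + 1) by rewrite divr_gt0.
move/cvgrPdist_le/(_ _ dM) : c0 => c0.
apply: filterS2 HM c0 => k [A [mA PA AM]]; rewrite sub0r normrN => ck.
exists A; split => // w Aw; rewrite normrM.
rewrite -[leRHS](divfK (lt0r_neq0 M1)) ler_pM// (le_trans (AM _ Aw))//.
by rewrite (le_trans (ler_norm _))// lerDl.
Qed.

Lemma op_le Y Z : op P Z ->
  (\forall k \near \oo, forall w, `|Y k w| <= `|Z k w|) -> op P Y.
Proof.
move=> oZ YZ eps delta eps0 delta0.
apply: filterS2 (oZ _ _ eps0 delta0) YZ => k [A [mA PA AM]] YZ.
by exists A; split=> // w Aw; apply: le_trans (AM _ Aw).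
Qed.

Lemma measurable_norm_ge (a : R) (f : T -> R) : measurable_fun setT f ->
  measurable [set w | a <= `|f w|].
Proof.
move=> mf; rewrite (_ : mkset _ = (fun w => `|f w|) @^-1` `[a, +oo[).
  have mN : measurable_fun setT (fun w => `|f w|) by exact: measurableT_comp.
  by rewrite -[X in measurable X]setTI; apply: mN.
by apply/seteqP; split=> w /=; rewrite in_itv/= andbT.
Qed.

(** The tail event is contained in the exceptional set [A]. Measurability of [Y k] makes the tail
    event measurable, so that its probability is at most that of [A]. *)
Lemma op_oP1 Y : (forall k, measurable_fun setT (Y k)) -> op P Y -> oP1 P Y.
Proof.
move=> mY oY eps eps0.
have mE k := measurable_norm_ge eps (mY k).
apply/fine_cvgP; split; first by apply: nearW => k; exact: fin_num_measure.
(* Outside [A] the bound on [Y k] is non-strict, and so is the inequality defining the tail event;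
   the level [eps / 2] separates the two. *)
apply/cvgrPdist_le => e e0; have eps2 : 0 < eps / 2 by rewrite divr_gt0.
apply: filterS (oY _ _ e0 eps2) => k [A [mA PA AY]].
rewrite sub0r normrN ger0_norm ?fine_ge0//= -lee_fin fineK ?fin_num_measure//.
apply: le_trans PA; apply: le_measure; rewrite ?inE// => w /= eY.
apply: contrapT => /AY; apply/negP; rewrite -ltNge (lt_le_trans _ eY)//.
by rewrite ltr_pdivrMr// ltr_pMr// ltr1n.
Qed.

End stochastic_order.

(** * Convergence in distribution implies tightness *)

Section tightness.
Context (d d' : measure_display) (T : measurableType d) (T' : measurableType d').
Context (R : realType) (P : probability T R) (P' : probability T' R).

(** A monotone function has only countably many jumps, whereas an interval of positive length has
    positive Lebesgue measure and is therefore uncountable. *)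
Lemma exists_cdf_continuous (V : {RV P' >-> R}) (a b : R) : a < b ->
  exists2 x : R, a < x < b & {for x, continuous (cdf V)}.
Proof.
move=> ab; pose f x := fine (cdf V x).
have fE x : cdf V x = (f x)%:E by rewrite /f fineK// fin_num_measure.
have fnd : {homo f : x y / x <= y}.
  by move=> x y xy; rewrite -lee_fin -!fE cdf_nondecreasing.
have cD : countable [set x | x \in (`]a, b[) /\ discontinuity f x].
  by apply: discontinuity_countable => x y _ _; exact: fnd.
have [x xab Dx] : exists2 x, (x \in `]a, b[) & (~ discontinuity f x).
  apply: contrapT => /forall2NP h.
  have : countable [set` `]a, b[].
    apply: sub_countable cD; apply: subset_card_le => x /= xab; split=> //.
    by case: (h x) => // /contrapT.
  move/countable_lebesgue_measure0; rewrite lebesgue_measure_itv/= lte_fin ab.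
  by move/eqP; rewrite -EFinB eqe subr_eq0 gt_eqF.
exists x; first by move: xab; rewrite in_itv.
(* [discontinuity] means a jump: both one-sided limits exist and differ. A cdf is right-continuous
   and, being monotone, has a left limit; having no jump at [x] forces this left limit to be
   [f x]. *)
have fr : f y @[y --> x^'+] --> f x.
  by apply: fine_cvg; rewrite -fE; exact: cdf_right_continuous.
have fl : cvg (f y @[y --> x^'-]).
  apply: nondecreasing_at_left_is_cvgr.
    by apply: nearW => y u v _ _; exact: fnd.
  apply: nearW => y; exists (f x) => _ [u /= + <-]; rewrite in_itv/= => /andP[_ ux].
  by apply: fnd; exact: ltW.
have lE : lim (f y @[y --> x^'-]) = f x.
  apply: contrapT => /eqP lN; apply: Dx; split=> //.
    by apply/cvg_ex; exists (f x).
  by rewrite (cvg_lim _ fr).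
have fc : f y @[y --> x] --> f x.
  by apply/left_right_continuousP; split=> //; rewrite -lE.
have -> : cdf V = EFin \o f by apply/funext => y; rewrite fE.
by apply/fine_cvgP; split; [exact: nearW|exact: fc].
Qed.

(** Continuity points [y] and [x] of the limit cdf are taken so far out that the limit law gives
    mass less than [eps / 2] to each outer tail. The same bounds hold for [Y n] once [n] is large,
    and off the two tails [y < Y n <= x]. *)
Lemma cvg_in_distribution_Op (Y : nat -> T -> R) (V : {RV P' >-> R}) :
  (forall n, measurable_fun setT (Y n)) -> cvg_in_distribution P Y V -> Op P Y.
Proof.
move=> mY YV eps eps0; have e2 : 0 < eps / 2 by rewrite divr_gt0.
have mle n x : measurable [set w | Y n w <= x].
  rewrite (_ : mkset _ = Y n @^-1` `]-oo, x]); last first.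
    by apply/seteqP; split=> w /=; rewrite in_itv.
  by rewrite -[X in measurable X]setTI; apply: mY.
pose f x := fine (cdf V x).
have Pf x : {for x, continuous (cdf V)} ->
    fine (P [set w | Y n w <= x]) @[n --> \oo] --> f x.
  by move=> /YV VY; apply: fine_cvg; rewrite fineK// fin_num_measure.
have [x xV xc] : exists2 x, 1 - eps / 2 < f x & {for x, continuous (cdf V)}.
  have fy : f x @[x --> +oo] --> (1 : R) by apply: fine_cvg; exact: cvg_cdfy1.
  have [|M [_ HM]] := cvgr_gt 1 fy (1 - eps / 2); first by rewrite gtrBl.
  have [|x /andP[Mx _] xc] := @exists_cdf_continuous V M (M + 1); first by rewrite ltrDl.
  by exists x => //; exact: HM.
have [y yV yc] : exists2 y, f y < eps / 2 & {for y, continuous (cdf V)}.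
  have fy : f x @[x --> -oo] --> (0 : R) by apply: fine_cvg; exact: cvg_cdfNy0.
  have [|M [_ HM]] := cvgr_lt 0 fy (eps / 2); first by [].
  have [|y /andP[_ My] yc] := @exists_cdf_continuous V (M - 1) M; first by rewrite gtrBl.
  by exists y => //; exact: HM.
exists (Num.max `|x| `|y|).
apply: filterS2 (cvgr_gt _ (Pf _ xc) _ xV) (cvgr_lt _ (Pf _ yc) _ yV) => n hx hy.
exists (~` [set w | Y n w <= x] `|` [set w | Y n w <= y]); split.
- by apply: measurableU; [exact: measurableC|].
- apply: probability_setU_le => //; first exact: measurableC.
    rewrite probability_setC// -[P _]fineK ?fin_num_measure// -EFinB lee_fin.
    by rewrite lerBlDr -lerBlDl ltW.
  by rewrite -[P _]fineK ?fin_num_measure// lee_fin ltW.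
- move=> w /not_orP[/contrapT /= wx /negP]; rewrite -ltNge => yw.
  rewrite ler_norml lerNl !le_max; apply/andP; split; apply/orP; [right|left].
    by rewrite -(normrN y) (le_trans _ (ler_norm _))// lerN2 ltW.
  by rewrite (le_trans wx)// ler_norm.
Qed.

End tightness.

(** * Sums of independent random variables *)

Section independence.
Context (d : measure_display) (T : measurableType d) (R : realType).
Context (P : probability T R).

Definition independent (X Y : T -> R) : Prop :=
  forall A B : set R, measurable A -> measurable B ->
    P (X @^-1` A `&` Y @^-1` B) = (P (X @^-1` A) * P (Y @^-1` B))%E.

(** By uniqueness of product measures, the joint law of [(X, Y)] is the product of the marginal
    laws; Fubini then factors the expectation of the product. *)
Lemma independent_covariance (X Y : {RV P >-> R}) : independent X Y ->
  (X : T -> R) \in Lfun P 2%:E -> (Y : T -> R) \in Lfun P 2%:E ->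
  covariance P X Y = 0%E.
Proof.
move=> XY X2 Y2.
have Pfin : P setT \is a fin_num := fin_num_measure P _ measurableT.
have X1 := Lfun_subset12 Pfin X2; have Y1 := Lfun_subset12 Pfin Y2.
have XY1 := Lfun2_mul_Lfun1 X2 Y2.
rewrite covarianceE//; apply/eqP; rewrite sube_eq ?add0e; last 2 first.
- exact: expectation_fin_num.
- by rewrite fin_num_adde_defl// fin_numM// expectation_fin_num.
apply/eqP.
have mXY : measurable_fun setT (fun w => (X w, Y w)) by exact: measurable_fun_pair.
pose XYm : {RV P >-> (R * R)%type} := mfun_Sub (mem_set mXY).
pose f (z : R * R) : \bar R := (z.1 * z.2)%:E.
have mf : measurable_fun [set: R * R] f.
  by apply/measurable_EFinP; apply: measurable_funM.
have prodE A : measurable A ->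
    (distribution P X \x distribution P Y)%E A = distribution P XYm A.
  by apply: product_measure_unique => B C mB mC; exact: XY.
have iXY : P.-integrable setT (f \o XYm) by exact/Lfun1_integrable.
(* Fubini requires integrability under the product measure; it is carried over from the
   integrability of [X * Y], which follows from square integrability. *)
have If : (distribution P X \x distribution P Y)%E.-integrable setT f.
  apply/integrableP; split=> //.
  rewrite (eq_measure_integral (distribution P XYm)); last first.
    by move=> A mA _; exact: prodE.
  have mXYm := measurable_funPT XYm.
  by have /integrableP[_] := integrable_pushforward mXYm mf iXY measurableT.
transitivity (\int[distribution P X \x distribution P Y]_z f z)%E.
  rewrite (eq_measure_integral (distribution P XYm)); last first.
    by move=> A mA _; exact: prodE.
  by rewrite integral_distribution// unlock.
rewrite -(integral12_prod_meas1 If) /fubini_F /f /=.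
have /Lfun1_integrable iX1 := X1; have /Lfun1_integrable iY1 := Y1.
have iX : (distribution P X).-integrable setT (EFin \o idfun).
  apply: integrable_pushforward => //.
  by apply/measurable_EFinP; exact: measurable_id.
have iY : (distribution P Y).-integrable setT (EFin \o idfun).
  apply: integrable_pushforward => //.
  by apply/measurable_EFinP; exact: measurable_id.
have EX : ('E_P[X] = \int[distribution P X]_x x%:E)%E.
  by rewrite unlock integral_distribution//; exact: iX1.
have EY : ('E_P[Y] = \int[distribution P Y]_x x%:E)%E.
  by rewrite unlock integral_distribution//; exact: iY1.
under eq_integral => x _.
  under eq_integral do rewrite EFinM.
  rewrite integralZl//.
  over.
rewrite -EY EX -(fineK (expectation_fin_num Y1)) integralZr//.
Qed.

End independence.

(** * Transfer of integrals between the law given by F and the probability space *)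

Section law.
Context (d : measure_display) (T : measurableType d) (R : realType).
Context (P : probability T R) (F : cumulativeBounded (0 : R) (1 : R)).

Lemma sqr_integrable_Lfun2 (f : T -> R) : measurable_fun setT f ->
  P.-integrable setT (fun w => (f w ^+ 2)%:E) -> f \in Lfun P 2%:E.
Proof.
move=> mf /integrableP[_ f2]; rewrite inE; apply/andP; split; rewrite inE//=.
rewrite /finite_norm unlock /Lnorm poweR_lty//.
under eq_integral => w _ do rewrite /= powR_mulrn// -normrX.
exact: f2.
Qed.

(* [lebesgue_stieltjes_measure F] lives on [measurableTypeR R], whose measurable
   sets are those of [R] but whose display differs; hence the type of [Y]. *)
Lemma distribution_lebesgue_stieltjes (Y : {RV P >-> measurableTypeR R}) :
  (forall x, P (Y @^-1` `]-oo, x]) = (F x)%:E) ->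
  forall A, measurable A ->
    lebesgue_stieltjes_measure F A = distribution P Y A.
Proof.
(* It is enough to compare the two measures on half-open intervals []a, b]], where both give
   [F b - F a], or 0 when [b < a]. *)
move=> YF A mA; apply: lebesgue_stieltjes_measure_unique => [I [[a b]]/= _ <-|//].
rewrite /lebesgue_stieltjes_measure /measure_extension/=.
rewrite measurable_mu_extE/=; last exact: is_ocitv.
have [ab|ba] := leP a b; last first.
  by rewrite set_itv_ge ?wlength0 ?measure0// bnd_simp -leNgt ltW.
rewrite wlength_itv_bnd// EFinB -!YF /distribution /pushforward.
have -> : `]a, b]%classic = `]-oo, b] `\` `]-oo, a].
  by rewrite -[RHS]setCK setCD setCitvl setUC -[LHS]setCK setCitv.
have mY c : measurable (Y @^-1` `]-oo, c]).
  by rewrite -[X in measurable X]setTI; exact: measurable_funPT.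
rewrite [in RHS]setDE preimage_setI preimage_setC -setDE measureD; last 3 first.
- exact: mY.
- exact: mY.
- by rewrite -ge0_fin_numE// fin_num_measure//; exact: mY.
congr (_ - P _)%E; rewrite setIidr// => w; apply: subset_itvl.
by rewrite bnd_simp.
Qed.

(** Change of variables, once the law of [Y] is identified with the Lebesgue-Stieltjes measure. It
    turns the moment hypotheses on F into moments of the observations. *)
Lemma integrable_law (Y : {RV P >-> R}) (f : R -> \bar R) :
  (forall x, cdf Y x = (F x)%:E) -> measurable_fun setT f ->
  (lebesgue_stieltjes_measure F).-integrable setT f ->
  P.-integrable setT (f \o Y) /\
  (\int[P]_w f (Y w) = \int[lebesgue_stieltjes_measure F]_x f x)%E.
Proof.
move=> YF mf fi.
have mY : @measurable_fun _ _ T (measurableTypeR R) setT Y := measurable_funPT Y.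
pose Y' : {RV P >-> measurableTypeR R} := 
  @mfun_Sub _ _ T (measurableTypeR R) Y (mem_set mY).
have Y'F A : measurable A -> lebesgue_stieltjes_measure F A = distribution P Y' A.
  exact: distribution_lebesgue_stieltjes.
have fY : P.-integrable setT (f \o Y').
  apply/integrableP; split; first exact: measurableT_comp.
  have m : @measurable_fun _ _ (measurableTypeR R) _ setT (fun x => `|f x|%E).
    exact: measurableT_comp.
  move/integrableP : fi => [_].
  rewrite (eq_measure_integral (distribution P Y')); last first.
    by move=> A mA _; exact: Y'F.
  by rewrite ge0_integral_distribution.
have mf' : @measurable_fun _ _ (measurableTypeR R) _ setT f := mf.
split=> //; rewrite -(integral_distribution mf' fY).
by apply: eq_measure_integral => A mA _; exact/esym/Y'F.
Qed.

End law.

(** * Normalized sums of i.i.d. random variables *)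

Section iid_sums.
Context (d : measure_display) (T : measurableType d) (R : realType).
Context (P : probability T R).

Lemma mutually_independent_pair (X : nat -> {RV P >-> R}) (f : R -> R) (i j : nat) :
  mutually_independent X -> measurable_fun setT f -> i != j ->
  independent P (f \o X i) (f \o X j).
Proof.
move=> Xind mf ij A B mA mB.
have mfA (C : set R) : measurable C -> measurable (f @^-1` C).
  by move=> mC; rewrite -[X in measurable X]setTI; exact: mf.
(* Mutual independence is applied to the index set [{i, j}]; the value of the family at indices
   other than [i] and [j] is irrelevant. *)
have mE k : measurable (if k == i then f @^-1` A else f @^-1` B).
  by case: ifP => _; exact: mfA.
have := Xind [fset i; j]%fset _ mE.
rewrite big_fsetU1/= ?inE// big_seq_fset1 eqxx eq_sym (negbTE ij) => <-.
congr (P _); apply/seteqP; split=> w /=.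
  move=> [Aw Bw] k; rewrite /= !inE => /orP[/eqP ->|/eqP ->]; first by rewrite eqxx.
  by rewrite eq_sym (negbTE ij).
move=> h; split.
  by have := h i; rewrite /= !inE !eqxx/=; exact.
by have := h j; rewrite /= !inE !eqxx orbT eq_sym (negbTE ij); exact.
Qed.

(** The summands are centred and pairwise uncorrelated with common variance [v], so the sum has
    variance [n * v] and Chebyshev applies at the scale of the square root of [n]. *)
Lemma Op_iid_sum (F : cumulativeBounded (0 : R) (1 : R))
    (X : nat -> {RV P >-> R}) (f : R -> R) :
  iid X F -> measurable_fun setT f ->
  (lebesgue_stieltjes_measure F).-integrable setT (fun x => (f x ^+ 2)%:E) ->
  (\int[lebesgue_stieltjes_measure F]_x (f x)%:E = 0)%E ->
  Op P (fun n w => (\sum_(i < n) f (X i w)) / Num.sqrt n%:R).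
Proof.
move=> [XF Xind] mf f2 f0.
pose L := lebesgue_stieltjes_measure F.
have mW i : measurable_fun setT (f \o X i) by exact: measurableT_comp.
pose W i : {RV P >-> R} := mfun_Sub (mem_set (mW i)).
have mf2 : measurable_fun setT (fun x => (f x ^+ 2)%:E).
  by apply/measurable_EFinP; exact: measurable_funX.
have W2 i : (W i : T -> R) \in Lfun P 2%:E.
  by apply: sqr_integrable_Lfun2 => //; exact: (integrable_law (XF i) mf2 f2).1.
have Pfin : P setT \is a fin_num := fin_num_measure P _ measurableT.
have f1 : L.-integrable setT (fun x => (f x)%:E).
  apply/Lfun1_integrable.
  have Lfin : L setT \is a fin_num := fin_num_measure L _ measurableT.
  by apply: Lfun_subset12 => //; exact: sqr_integrable_Lfun2.
have EW i : ('E_P[W i] = 0)%E.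
  by rewrite unlock -f0; apply: (integrable_law (XF i) _ f1).2; exact/measurable_EFinP.
pose v := (\int[L]_x (f x ^+ 2)%:E)%E.
have VW i : ('V_P[W i] = v)%E.
  rewrite varianceE// EW expe2 mule0 sube0 unlock.
  exact: (integrable_law (XF i) mf2 f2).2.
have vfin : v \is a fin_num by exact: integrable_fin_num.
pose S n (w : T) := \sum_(i < n) W i w.
have SS n : S n.+1 = S n \+ W n by apply/funext => w; rewrite /S big_ord_recr.
have S0 : S 0%N = cst 0 by apply/funext => w; rewrite /S big_ord0.
have S2 n : S n \in Lfun P 2%:E.
  elim: n => [|n IH]; first by rewrite S0 Lfun_cst.
  by rewrite SS rpredD ?lee1n.
(* Pairwise independence is enough: covariance is additive in its first argument, and [W n] is not
   among the summands of [S k]. *)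
have SW k n : (k <= n)%N -> covariance P (S k) (W n) = 0%E.
  elim: k => [|k IH] kn; first by rewrite S0 covariance_cst_l.
  rewrite SS covarianceDl// IH ?(ltnW kn)// add0e independent_covariance//.
  by apply: mutually_independent_pair => //; rewrite ltn_eqF.
have VS n : ('V_P[S n] = (n%:R * fine v)%:E)%E.
  elim: n => [|n IH]; first by rewrite S0 variance_cst mul0r.
  rewrite SS varianceD// SW// mule0 adde0 IH VW -[in LHS](fineK vfin) -EFinD.
  by rewrite -natr1 mulrDl mul1r.
have ES n : ('E_P[S n] = 0)%E.
  elim: n => [|n IH]; first by rewrite S0 expectation_cst.
  by rewrite SS expectationD ?(Lfun_subset12 Pfin)// IH EW adde0.
have v0 : 0 <= fine v.
  by apply: fine_ge0; apply: integral_ge0 => x _; rewrite lee_fin sqr_ge0.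
(* With this [M] Chebyshev's bound is [v / M ^+ 2 = eps * (v / (v + 1))], at most [eps]; the added 1
   keeps [M] positive when [v = 0]. *)
move=> eps eps0; pose M := Num.sqrt ((fine v + 1) / eps).
have M0 : 0 < M by rewrite sqrtr_gt0 divr_gt0// ltr_wpDl.
exists M; near=> n.
have n0 : 0 < n%:R :> R by rewrite ltr0n; near: n; exact: nbhs_infty_gt.
have sn0 : 0 < Num.sqrt n%:R :> R by rewrite sqrtr_gt0.
have mS : measurable_fun setT (S n).
  by have := S2 n; rewrite inE => /andP[]; rewrite inE.
pose Sm : {RV P >-> R} := mfun_Sub (mem_set mS).
exists [set w | (M * Num.sqrt n%:R) <= `|S n w|]; split.
- exact: measurable_norm_ge.
- have := @chebyshev _ _ _ P Sm (M * Num.sqrt n%:R) (mulr_gt0 M0 sn0).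
  rewrite ES/= VS.
  under eq_set do rewrite subr0.
  move/le_trans; apply; rewrite -EFinM lee_fin exprMn !sqr_sqrtr ?(ltW n0)//; last first.
    by rewrite divr_ge0// ?(ltW eps0)// addr_ge0.
  have v1 : 0 < fine v + 1 by rewrite ltr_wpDl.
  rewrite (_ : _ * _ = eps * (fine v / (fine v + 1))).
    by rewrite ger_pMr// ler_pdivrMr// mul1r lerDl.
  by field; rewrite !lt0r_neq0.
- move=> w /= /negP; rewrite -ltNge => Sw.
  by rewrite normrM normfV (gtr0_norm sn0) ler_pdivrMr// ltW.
Unshelve. all: by end_near. Qed.

End iid_sums.

(** * Sample statistics *)

(** The superlevel set of [H] is the image of that of [G] under the increasing map sending [y] to
    [a + b * y], which commutes with infima. *)
Lemma quantile_affine (R : realType) (G : cumulativeBounded (0 : R) (1 : R))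
    (H : R -> R) (a b p : R) : 0 < b -> 0 < p -> p < 1 ->
  (forall x, H x = G ((x - a) / b)) -> quantile H p = a + b * quantile G p.
Proof.
move=> b0 p0 p1 HG; have bn : b != 0 by rewrite gt_eqF.
have HE y : H (a + b * y) = G y by rewrite HG addrAC subrr add0r mulrC mulKf.
(* The limits of [G] at both infinities, with [0 < p < 1], make the superlevel set bounded below and
   nonempty, so its [inf] is a true infimum and not a default value. *)
have [M HM] : exists M, forall y, p <= G y -> M <= y.
  have [M [_ HM]] := cvgr_lt 0 (cumulativeNy G) p p0.
  by exists M => y; rewrite [M <= y]leNgt; apply: contraTN => /HM; rewrite -ltNge.
have [N HN] : exists N, p <= G N.
  have [N [_ HN]] := cvgr_gt 1 (cumulativey G) p p1.
  by exists (N + 1); apply/ltW/HN; rewrite ltrDl.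
apply/le_anti/andP; split.
- rewrite -lerBlDl -ler_pdivrMl//; apply: lb_le_inf; first by exists N.
  move=> y /= py; rewrite ler_pdivrMl// lerBlDl; apply: ge_inf; last by rewrite /= HE.
  exists (a + b * M) => x /=; rewrite HG => /HM.
  by rewrite ler_pdivlMr// lerBrDl mulrC.
- apply: lb_le_inf; first by exists (a + b * N); rewrite /= HE.
  move=> x /=; rewrite HG => px; rewrite -lerBrDl mulrC -ler_pdivlMr//.
  by apply: ge_inf px; exists M => y /=; exact: HM.
Qed.

Section sample_statistics.
Context (R : realType).

Lemma measurable_sample (d : measure_display) (T : measurableType d)
    (P : probability T R) (X : nat -> {RV P >-> R}) (n : nat) :
  measurable_fun setT (sample X n).
Proof.
apply/measurable_fun_tnthP => i; rewrite (_ : _ \o _ = X i)//.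
by apply/funext => w /=; rewrite tnth_mktuple.
Qed.

Lemma measurable_sample_mean (n : nat) :
  measurable_fun [set: n.-tuple R] (@sample_mean R n).
Proof.
apply: measurable_funM => //; apply: measurable_sum => i.
exact: measurable_tnth.
Qed.

Lemma measurable_sample_sd (n : nat) :
  measurable_fun [set: n.-tuple R] (@sample_sd R n).
Proof.
have mq : measurable_fun setT (@Num.sqrt R).
  by apply: continuous_measurable_fun; exact: sqrt_continuous.
apply: (measurableT_comp mq).
apply: measurable_funM => //; apply: measurable_sum => i; apply: measurable_funX.
by apply: measurable_funB; [exact: measurable_tnth|exact: measurable_sample_mean].
Qed.

Lemma sample_sd_ge0 (n : nat) (x : n.-tuple R) : 0 <= sample_sd x.
Proof. exact: sqrtr_ge0. Qed.

Lemma measurable_inv_sample_sd (n : nat) :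
  measurable_fun [set: n.-tuple R] (fun x => (sample_sd x)^-1).
Proof.
(* Inversion is not continuous at 0, so measurability is obtained from the real power with exponent
   -1, which agrees with the inverse on non-negative numbers, 0 included. *)
under eq_fun do rewrite -powR_inv1 ?sample_sd_ge0//.
apply: (measurableT_comp (measurable_powR _)); exact: measurable_sample_sd.
Qed.

Lemma sample_mean_dev (n : nat) (x : n.-tuple R) (c : R) : (0 < n)%N ->
  Num.sqrt n%:R * (sample_mean x - c) =
  (\sum_(i < n) (tnth x i - c)) / Num.sqrt n%:R.
Proof.
move=> n0; have s0 : Num.sqrt n%:R != 0 :> R by rewrite sqrtr_eq0 -ltNge ltr0n.
rewrite sumrB sumr_const card_ord -(mulr_natl c) /sample_mean.
have := @sqr_sqrtr R n%:R (ler0n _ _); move: (Num.sqrt _) s0 => s s0 <-.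
by field.
Qed.

(** Change of centre: with [c] the true mean, the sample variance is expressed through sums of
    i.i.d. terms. *)
Lemma sum_sqr_dev (n : nat) (x : n.-tuple R) (c : R) : (0 < n)%N ->
  \sum_(i < n) (tnth x i - sample_mean x) ^+ 2 =
  \sum_(i < n) (tnth x i - c) ^+ 2 - (\sum_(i < n) (tnth x i - c)) ^+ 2 / n%:R.
Proof.
move=> n0; have nn0 : n%:R != 0 :> R by rewrite pnatr_eq0 -lt0n.
pose D := sample_mean x - c.
have DE : \sum_(i < n) (tnth x i - c) = n%:R * D.
  by rewrite sumrB sumr_const card_ord -(mulr_natl c) /D /sample_mean; field.
rewrite (eq_bigr (fun i => (tnth x i - c) ^+ 2 +
    (- D *+ 2 * (tnth x i - c) + D ^+ 2))); last first.
  by move=> i _; rewrite /D; ring.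
rewrite big_split big_split /= -mulr_sumr DE sumr_const card_ord.
rewrite -(mulr_natl (D ^+ 2)).
by field.
Qed.

Lemma sample_sd_sqr (n : nat) (x : n.-tuple R) :
  sample_sd x ^+ 2 = (\sum_(i < n) (tnth x i - sample_mean x) ^+ 2) / n.-1%:R.
Proof. by rewrite sqr_sqrtr// divr_ge0// sumr_ge0// => i _; rewrite sqr_ge0. Qed.

(** A Lipschitz bound replacing the delta method. The constant 3/4 forces [S >= s / 2], since
    [s ^+ 2 - 3 / 4 * s ^+ 2 = (s / 2) ^+ 2]; then the denominator [S * (s + S)] is at least
    [s ^+ 2 / 2]. *)
Lemma inv_rate (s S : R) : 0 < s -> 0 <= S ->
  `|S ^+ 2 - s ^+ 2| <= 3 / 4 * s ^+ 2 ->
  `|s / S - 1| <= 2 / s ^+ 2 * `|S ^+ 2 - s ^+ 2|.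
Proof.
move=> s0 S0 h.
have S2 : s / 2 <= S.
  have s2 : 0 <= s / 2 by rewrite divr_ge0// ltW.
  rewrite -ler_sqr ?nnegrE// expr_div_n.
  by move: h; rewrite ler_norml => /andP[h _]; lra.
have Sp : 0 < S by rewrite (lt_le_trans _ S2)// divr_gt0.
have -> : s / S - 1 = - (S ^+ 2 - s ^+ 2) / (S * (s + S)).
  by field; rewrite !lt0r_neq0// addr_gt0.
rewrite normrM normrN normfV mulrC ler_wpM2r//.
rewrite gtr0_norm ?mulr_gt0 ?addr_gt0// -[leRHS]invf_div.
rewrite lef_pV2 ?posrE ?mulr_gt0 ?addr_gt0 ?divr_gt0 ?exprn_gt0//.
nra.
Qed.

End sample_statistics.

(** * Rates of convergence and the expansion *)

Section rates.
Context (d : measure_display) (T : measurableType d) (R : realType).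
Context (P : probability T R).
Implicit Types X : nat -> {RV P >-> R}.

(** Reduces the additional sample to one with distribution function F, for which the moments are
    known. *)
Lemma iid_translate X (F : R -> R) (a : R) : iid X (fun x => F (x - a)) ->
  exists2 Z : nat -> {RV P >-> R}, iid Z F & forall i w, Z i w = X i w - a.
Proof.
move=> [XF Xind].
have mZ i : measurable_fun setT (fun w => X i w - a) by exact: measurable_funB.
exists (fun i => mfun_Sub (mem_set (mZ i))) => //; split.
  move=> i x; rewrite -[in RHS](addrK a x) -(XF i) /cdf /distribution /pushforward.
  by congr (P _); apply/seteqP; split=> w /=; rewrite !in_itv/= lerBlDr.
have mB (A : set R) : measurable A -> measurable ((fun x => x - a) @^-1` A).
  move=> mA; rewrite -[X in measurable X]setTI.
  by apply: (measurable_funB _ _ : measurable_fun setT (fun x : R => x - a)).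
by move=> J A mA; exact: Xind J _ (fun i => mB _ (mA i)).
Qed.

Lemma Op_sample_sd X (mu sigma : R) : 0 < sigma ->
  Op P (fun m w => (\sum_(i < m) (X i w - mu)) / Num.sqrt m%:R) ->
  Op P (fun m w => (\sum_(i < m) ((X i w - mu) ^+ 2 - sigma ^+ 2))
    / Num.sqrt m%:R) ->
  Op P (fun m w => Num.sqrt m%:R * (sigma / sample_sd (sample X m w) - 1)).
Proof.
move=> s0 OA OB.
pose A m w := (\sum_(i < m) (X i w - mu)) / Num.sqrt m%:R.
pose B m w := (\sum_(i < m) ((X i w - mu) ^+ 2 - sigma ^+ 2)) / Num.sqrt m%:R.
have bnd (c : nat -> R) : (forall m, (1 < m)%N -> `|c m| <= 2) ->
    Op P (fun m _ => c m).
  move=> c2; apply: Op_cst; exists 2; near=> m; apply: c2; near: m.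
  exact: nbhs_infty_gt.
have OE : Op P (fun m w => Num.sqrt m%:R *
    (sample_sd (sample X m w) ^+ 2 - sigma ^+ 2)).
  have c1 : Op P (fun m _ => m%:R / m.-1%:R).
    apply: bnd => -[|[|m]]// _; rewrite /= ger0_norm ?divr_ge0//.
    by rewrite ler_pdivrMr// -!natr1; have := ler0n R m; lra.
  have c2 : Op P (fun m _ => Num.sqrt m%:R / m.-1%:R).
    apply: bnd => -[|[|m]]// _; rewrite /= ger0_norm ?divr_ge0//.
    rewrite ler_pdivrMr// -ler_sqr ?nnegrE ?sqrtr_ge0 ?mulr_ge0// sqr_sqrtr//.
    by rewrite -!natr1; have := ler0n R m; nra.
  (* For [m > 1] this expression equals the scaled variance error exactly: [A] is the correction for
     the estimated mean, [B] the centred sum of squares, and the deterministic factors are at most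
     2. *)
  have OZ : Op P (fun m w => m%:R / m.-1%:R * B m w
      + Num.sqrt m%:R / m.-1%:R * (sigma ^+ 2 + (-1) * (A m w * A m w))).
    apply: OpD; apply: OpM => //; apply: OpD.
      by apply: Op_cst; exists `|sigma ^+ 2|; apply: nearW.
    by apply: OpZ; exact: OpM.
  apply: Op_le OZ _; near=> m; have m1 : (1 < m)%N by near: m; exact: nbhs_infty_gt.
  move=> w; rewrite le_eqVlt; apply/orP; left; apply/eqP; congr `|_|.
  rewrite sample_sd_sqr (sum_sqr_dev _ mu) ?(ltn_trans _ m1)// /A /B.
  under eq_bigr do rewrite tnth_mktuple.
  under [X in _ - X ^+ 2 / _]eq_bigr do rewrite tnth_mktuple.
  have -> : \sum_(i < m) ((X i w - mu) ^+ 2 - sigma ^+ 2) =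
      \sum_(i < m) (X i w - mu) ^+ 2 - m%:R * sigma ^+ 2.
    by rewrite sumrB sumr_const card_ord -(mulr_natl (sigma ^+ 2)).
  set a := \sum_(i < m) (X i w - mu); set b := \sum_(i < m) _.
  have -> : m.-1%:R = m%:R - 1 :> R by rewrite -{2}(prednK (ltnW m1)) -natr1 addrK.
  have n1 : 1 < m%:R :> R by rewrite ltr1n.
  have := @sqr_sqrtr R m%:R (ler0n _ _).
  have : Num.sqrt m%:R != 0 :> R by rewrite sqrtr_eq0 -ltNge ltr0n ltnW.
  move: (Num.sqrt _) n1 => s; move: (m%:R : R) => M M1 sn0 sM; rewrite -{}sM in M1 *.
  by field; rewrite sn0 subr_eq0 gt_eqF.
move=> eps eps0; have [M HM] := OE _ eps0; exists (2 / sigma ^+ 2 * M).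
near=> m.
have m0 : 0 < Num.sqrt m%:R :> R.
  by rewrite sqrtr_gt0 ltr0n; near: m; exact: nbhs_infty_gt.
have c0 : 0 < 3 / 4 * sigma ^+ 2 by rewrite mulr_gt0// exprn_gt0.
(* For large [m] the variance error off the exceptional set, at most [M] over the square root of
   [m], meets the smallness condition of [inv_rate]. *)
have mM : M <= Num.sqrt m%:R * (3 / 4 * sigma ^+ 2).
  rewrite -ler_pdivrMr//; apply: le_trans (ler_norm _) _; rewrite -sqrtr_sqr.
  by apply: ler_wsqrtr; near: m; exact: nbhs_infty_ger.
have [D [mD PD DM]] : exists D : set T, [/\ measurable D, (P D <= eps%:E)%E &
    forall w, ~ D w -> `|Num.sqrt m%:R *
      (sample_sd (sample X m w) ^+ 2 - sigma ^+ 2)| <= M].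
  by near: m.
exists D; split=> // w /DM; rewrite !normrM (gtr0_norm m0) => wM.
have := inv_rate s0 (sample_sd_ge0 (sample X m w)).
move/(_ _)/(ler_wpM2l (ltW m0)) => h; apply: (le_trans (h _)).
  by rewrite -(ler_pM2l m0) (le_trans wM).
by rewrite mulrCA ler_wpM2l// divr_ge0// sqr_ge0.
Unshelve. all: by end_near. Qed.

Lemma expansion_of_rate X X0 (mu sigma tau g : R)
    (q : forall m : nat, m.-tuple R -> R) :
  0 < sigma -> tau = mu + sigma * g -> estimator q ->
  Op P (fun n w => (\sum_(i < n) (X i w - mu)) / Num.sqrt n%:R) ->
  Op P (fun m w => Num.sqrt m%:R * (sigma / sample_sd (sample X0 m w) - 1)) ->
  Op P (fun m w => Num.sqrt m%:R * (q m (sample X0 m w) - g)) ->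
  expansion mu sigma tau X X0 q.
Proof.
move=> s0 -> mq OX OS Oq n m noo moo nm0.
apply: op_oP1.
  move=> k; have mX := @measurable_sample R d T P X (n k).
  have mX0 := @measurable_sample R d T P X0 (m k).
  have mean := measurableT_comp (@measurable_sample_mean R (n k)) mX.
  have isd := measurableT_comp (@measurable_inv_sample_sd R (m k)) mX0.
  have mqk := measurableT_comp (mq (m k)) mX0.
  apply: measurable_funB; last apply: measurable_funB.
  - apply: measurable_funM => //; apply: measurable_funM isd.
    exact: measurable_funB.
  - apply: measurable_funM => //; apply: measurable_funM => //.
    exact: measurable_funB.
  - exact: measurable_funM.
have OXn : Op P (fun k w => (\sum_(i < n k) (X i w - mu)) / Num.sqrt (n k)%:R) :=
  Op_comp OX noo.
have OSm : Op P (fun k w => Num.sqrt (m k)%:R *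
    (sigma / sample_sd (sample X0 (m k) w) - 1)) :=
  Op_comp OS moo.
have Oqm : Op P (fun k w => Num.sqrt (m k)%:R *
    (q (m k) (sample X0 (m k) w) - g)) :=
  Op_comp Oq moo.
have c1 : Num.sqrt (m k)%:R^-1 @[k --> \oo] --> (0 : R).
  have mR : (m k)%:R @[k --> \oo] --> (+oo : set_system R).
    exact: cvg_comp moo (@cvgr_idn R).
  have m1 : (m k)%:R^-1 @[k --> \oo] --> (0 : R).
    apply/gtr0_cvgV0 => //; near=> k; rewrite ltr0n; near: k.
    exact: (moo _ (nbhs_infty_gt 0)).
  by have := continuous_cvg _ (@sqrt_continuous R 0) m1; rewrite sqrtr0; apply.
have c2 : Num.sqrt ((n k)%:R / (m k)%:R) @[k --> \oo] --> (0 : R).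
  by have := continuous_cvg _ (@sqrt_continuous R 0) nm0; rewrite sqrtr0; apply.
(* [o1] is the standardized mean times r, which vanishes because [m] diverges; [o2] collects the two
   terms carrying the square root of [n], which vanish because [n / m] tends to 0. *)
have o1 := op_scale c1 (OpM (OpZ sigma^-1 OXn) OSm).
have o2 := op_scale c2 (OpD Oqm (OpZ (- g) OSm)).
apply: op_le (opD o1 o2) _.
near=> k; have n0 : (0 < n k)%N by near: k; exact: (noo _ (nbhs_infty_gt 0)).
have m0 : (0 < m k)%N by near: k; exact: (moo _ (nbhs_infty_gt 0)).
move=> w; rewrite le_eqVlt; apply/orP; left; apply/eqP; congr `|_|.
rewrite /control_statistic /standardized_mean.
have E := sample_mean_dev (sample X (n k) w) mu n0.
under [in RHS]eq_bigr do rewrite -(tnth_mktuple (fun i : 'I_(n k) => X i w)).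
rewrite -E sqrtrM// sqrtrV//.
have sm : Num.sqrt (m k)%:R != 0 :> R by rewrite sqrtr_eq0 -ltNge ltr0n.
set S := sample_sd _; set Q := q _ _; set xb := sample_mean _.
have sn : sigma != 0 by rewrite gt_eqF.
(* The identity is polynomial in the inverse of [S], so it also holds where [S = 0] and the inverse
   is 0 by convention. *)
move: (S^-1) => iS.
by field; rewrite sm.
Unshelve. all: by end_near. Qed.
End rates.

(** * Rates from the moment hypotheses, the standardized quantile estimator, and the conclusion *)

Lemma Op_iid_moments (d : measure_display) (T : measurableType d) (R : realType)
    (P : probability T R) (F : cumulativeBounded (0 : R) (1 : R))
    (X : nat -> {RV P >-> R}) (mu sigma : R) :
  (lebesgue_stieltjes_measure F).-integrable setT (fun x : R => (x ^+ 4)%:E) ->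
  (\int[lebesgue_stieltjes_measure F]_x (x%:E) = mu%:E)%E ->
  (\int[lebesgue_stieltjes_measure F]_x (((x - mu) ^+ 2)%:E) = (sigma ^+ 2)%:E)%E ->
  iid X F ->
  Op P (fun n w => (\sum_(i < n) (X i w - mu)) / Num.sqrt n%:R) /\
  Op P (fun n w => (\sum_(i < n) ((X i w - mu) ^+ 2 - sigma ^+ 2)) / Num.sqrt n%:R).
Proof.
move=> F4 F1 F2 XF; set L := lebesgue_stieltjes_measure F.
have m1 : measurable_fun setT (fun x : R => x - mu) by exact: measurable_funB.
have m2 : measurable_fun setT (fun x : R => (x - mu) ^+ 2) by exact: measurable_funX.
have m3 : measurable_fun setT (fun x : R => (x - mu) ^+ 2 - sigma ^+ 2).
  exact: measurable_funB.
have cstL (c : R) : L.-integrable setT (fun=> c%:E).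
  by apply: finite_measure_integrable_cst.
(* The integrand is non-negative with finite integral [sigma ^+ 2], hence integrable; integrability
   of [x - mu] and of [x] follows from it. *)
have i2 : L.-integrable setT (fun x : R => ((x - mu) ^+ 2)%:E).
  apply/integrableP; split; first exact/measurable_EFinP.
  under eq_integral => x _ do rewrite gee0_abs ?lee_fin ?sqr_ge0//.
  by rewrite F2 ltry.
have i1 : L.-integrable setT (fun x : R => (x - mu)%:E).
  apply/Lfun1_integrable.
  have Lfin : L setT \is a fin_num := fin_num_measure L _ measurableT.
  by apply: Lfun_subset12 => //; exact: sqr_integrable_Lfun2.
have i0 : L.-integrable setT (fun x : R => x%:E).
  apply: eq_integrable (integrableD measurableT i1 (cstL mu)) => // x _.
  by rewrite -EFinD subrK.
have Lc (c : R) : (\int[L]_x c%:E = c%:E)%E.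
  have LT : L setT = 1%E by exact: probability_setT.
  by rewrite integral_cst// [X in (_ * X)%E]LT mule1.
split.
- apply: (Op_iid_sum (f := fun x => x - mu) XF) => //.
  under eq_integral do rewrite EFinB.
  by rewrite integralB// F1 Lc subee.
- apply: (Op_iid_sum (f := fun x => (x - mu) ^+ 2 - sigma ^+ 2) XF) => //; last first.
    under eq_integral do rewrite EFinB.
    by rewrite integralB// F2 Lc subee.
  (* Dominating function obtained by using [(a + b) ^+ 2 <= 2 * a ^+ 2 + 2 * b ^+ 2] three times: to
     separate [sigma ^+ 2], to bound [(x - mu) ^+ 2], and to bound the square of that bound, giving
     the factor 16. *)
  have i4 : L.-integrable setT (fun x : R =>
      (16 * x ^+ 4 + (16 * mu ^+ 4 + 2 * sigma ^+ 4))%:E).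
    under eq_fun do rewrite EFinD EFinM.
    by apply: integrableD => //; exact: integrableZl.
  apply: le_integrable i4 => //.
    by apply/measurable_EFinP; exact: measurable_funX.
  move=> x _; rewrite !abse_EFin lee_fin.
  rewrite !ger0_norm ?sqr_ge0//; last first.
    by rewrite !addr_ge0// mulr_ge0// exprn_even_ge0.
  have hu : (x - mu) ^+ 2 <= 2 * x ^+ 2 + 2 * mu ^+ 2.
    by have := sqr_ge0 (x + mu); nra.
  have hu2 : ((x - mu) ^+ 2) ^+ 2 <= (2 * x ^+ 2 + 2 * mu ^+ 2) ^+ 2.
    by rewrite ler_sqr ?nnegrE ?sqr_ge0// addr_ge0// mulr_ge0// sqr_ge0.
  have hx := sqr_ge0 (x ^+ 2 - mu ^+ 2).
  have hs := sqr_ge0 ((x - mu) ^+ 2 + sigma ^+ 2).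
  apply: (@le_trans _ _ (2 * ((x - mu) ^+ 2) ^+ 2 + 2 * sigma ^+ 4)); nra.
Qed.

Lemma Op_quantile_rate (d : measure_display) (T : measurableType d)
    (R : realType) (P : probability T R) (X : nat -> {RV P >-> R})
    (mu sigma g q : R) (Fq : forall m : nat, m.-tuple R -> R) :
  0 < sigma -> q = mu + sigma * g ->
  Op P (fun m w => (\sum_(i < m) (X i w - mu)) / Num.sqrt m%:R) ->
  Op P (fun m w => Num.sqrt m%:R * (sigma / sample_sd (sample X m w) - 1)) ->
  Op P (fun m w => Num.sqrt m%:R * (Fq m (sample X m w) - q)) ->
  Op P (fun m w => Num.sqrt m%:R *
    ((Fq m (sample X m w) - sample_mean (sample X m w)) / sample_sd (sample X m w)
     - g)).
Proof.
move=> s0 qE OX OS OF; have sn : sigma != 0 by rewrite gt_eqF.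
(* With r as in the overview, the inverse of S_m is [sigma^-1 * (1 + r)], and r is O_P(1) since it
   is a bounded factor times its scaled version. *)
have OI : Op P (fun m w => (sample_sd (sample X m w))^-1).
  have O2 : Op P (fun m _ => (Num.sqrt m%:R)^-1).
    apply: Op_cst; exists 1; near=> m.
    have m1 : 1 <= Num.sqrt m%:R :> R.
      by rewrite -[leLHS]sqrtr1 ler_wsqrtr// ler1n; near: m; exact: nbhs_infty_gt.
    by rewrite ger0_norm ?invr_ge0// invf_le1// (lt_le_trans ltr01).
  have O3 : Op P (fun m w => sigma^-1 *
      (1 + (Num.sqrt m%:R)^-1 *
        (Num.sqrt m%:R * (sigma / sample_sd (sample X m w) - 1)))).
    apply: OpZ; apply: OpD; last exact: OpM.
    by apply: Op_cst; exists 1; apply: nearW => _; rewrite normr1.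
  apply: Op_le O3 _; near=> m => w; rewrite mulKf; last first.
    by rewrite sqrtr_eq0 -ltNge ltr0n; near: m; exact: nbhs_infty_gt.
  by rewrite addrC subrK mulKf.
have OA := OpD (OpD (OpM OF OI) (OpZ (-1) (OpM OX OI))) (OpZ g OS).
apply: Op_le OA _; near=> m => w.
rewrite le_eqVlt; apply/orP; left; apply/eqP; congr `|_|.
have m0 : (0 < m)%N by near: m; exact: nbhs_infty_gt.
have E := sample_mean_dev (sample X m w) mu m0.
under [in RHS]eq_bigr do rewrite -(tnth_mktuple (fun i : 'I_m => X i w)).
by rewrite -E qE; ring.
Unshelve. all: by end_near. Qed.

Theorem proposition1 (R : realType)
  (F G : cumulativeBounded (0 : R) (1 : R)) (mu sigma Delta tau p : R)
  (d : measure_display) (T : measurableType d) (P : probability T R)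
  (X0 X1 X2 : nat -> {RV P >-> R})
  (sigma_gt0 : 0 < sigma)
  (F_moment4 : (lebesgue_stieltjes_measure F).-integrable setT
                 (fun x : R => (x ^+ 4)%:E))
  (F_mean : (\int[lebesgue_stieltjes_measure F]_x (x%:E) = mu%:E)%E)
  (F_var : (\int[lebesgue_stieltjes_measure F]_x (((x - mu) ^+ 2)%:E)
            = (sigma ^+ 2)%:E)%E)
  (G_mean : (\int[lebesgue_stieltjes_measure G]_x (x%:E) = 0)%E)
  (G_moment2 : (\int[lebesgue_stieltjes_measure G]_x ((x ^+ 2)%:E) = 1)%E)
  (F_G : forall x : R, F x = G ((x - mu) / sigma))
  (X0_iid : iid X0 (fun x => F (x - Delta)))
  (X1_iid : iid X1 F)
  (X2_iid : iid X2 F)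
  (X1_X2_indep : independent_samples X1 X2)
  (p_def : p = F tau)
  (p_gt0 : 0 < p) (p_lt1 : p < 1)
  (tau_def : tau = quantile F p) :
  (forall (Gq : forall m : nat, m.-tuple R -> R)
     (d' : measure_display) (T' : measurableType d') (P' : probability T' R)
     (V : {RV P' >-> R}),
     estimator Gq ->
     cvg_in_distribution P
       (fun m w => Num.sqrt m%:R * (Gq m (sample X0 m w) - quantile G p)) V ->
     expansion mu sigma tau X1 X0 Gq /\ expansion mu sigma tau X2 X0 Gq) /\
  (forall (Fq : forall m : nat, m.-tuple R -> R)
     (d' : measure_display) (T' : measurableType d') (P' : probability T' R)
     (U : {RV P' >-> R}),
     estimator Fq ->
     cvg_in_distribution P
       (fun m w => Num.sqrt m%:R * (Fq m (sample X0 m w)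
                   - quantile (fun x => F (x - Delta)) p)) U ->
     let Gq (m : nat) (x : m.-tuple R) := (Fq m x - sample_mean x) / sample_sd x in
     expansion mu sigma tau X1 X0 Gq /\ expansion mu sigma tau X2 X0 Gq).
Proof.
have tauE : tau = mu + sigma * quantile G p.
  by rewrite tau_def; apply: quantile_affine.
have [OX1 _] := Op_iid_moments F_moment4 F_mean F_var X1_iid.
have [OX2 _] := Op_iid_moments F_moment4 F_mean F_var X2_iid.
(* [Z i] is [X0 i - Delta], so [Z i - mu] is the additional observation centred at its own mean
   [mu + Delta]; the rewrites below put the sums in that form. *)
have [Z Z_iid ZE] := iid_translate X0_iid.
have [] := Op_iid_moments F_moment4 F_mean F_var Z_iid.
under eq_fun do
  under eq_fun do under eq_bigr do rewrite ZE -addrA -opprD (addrC Delta).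
move=> OX0.
under eq_fun do
  under eq_fun do under eq_bigr do rewrite ZE -addrA -opprD (addrC Delta).
move=> OX0sq; have OS := Op_sample_sd sigma_gt0 OX0 OX0sq.
have msample m := @measurable_sample R d T P X0 m.
split=> [Gq d' T' P' V mGq GV|Fq d' T' P' U mFq FU Gq].
  have OG := cvg_in_distribution_Op (fun m =>
    measurable_funM (measurable_cst _) (measurable_funB
      (measurableT_comp (mGq m) (msample m)) (measurable_cst _))) GV.
  by split; apply: expansion_of_rate OS OG.
(* The law of the additional sample belongs to the same location-scale family, with location
   [mu + Delta] and unchanged scale. *)
have qE : quantile (fun x => F (x - Delta)) p = mu + Delta + sigma * quantile G p.
  by apply: quantile_affine => // x; rewrite F_G opprD addrA addrAC.
have OF := cvg_in_distribution_Op (fun m =>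
  measurable_funM (measurable_cst _) (measurable_funB
    (measurableT_comp (mFq m) (msample m)) (measurable_cst _))) FU.
have OG := Op_quantile_rate sigma_gt0 qE OX0 OS OF.
have mGq : estimator Gq.
  move=> m; apply: measurable_funM; last exact: measurable_inv_sample_sd.
  by apply: measurable_funB; [exact: mFq|exact: measurable_sample_mean].
by split; apply: expansion_of_rate OS OG.
Qed.
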